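(* Let $-1<\alpha<0$, $-1<\beta$, and let $n\geqslant4$ be an integer. Define $$\Phi_n(x;\mu)=\sum_{k=0}^{n}\Big(\frac{d^k}{dx^k}P_n^{(\alpha,\beta-1)}(x)\Big)\mu^k .$$ Then every zero $\mu\in\mathbb{C}$ of the polynomial $\mu\mapsto\Phi_n(1;\mu)$ satisfies $\operatorname{Re}\mu<0$.
   Context: For real $a$ and integer $m\geqslant0$, $(a)_m=a(a+1)\cdots(a+m-1)$, $(a)_0=1$. For real $\alpha>-1$ and real $\beta$, the Jacobi polynomial is $$P_n^{(\alpha,\beta)}(x)=\frac{(\alpha+1)_n}{n!}\sum_{k=0}^{n}\frac{(-n)_k(n+\alpha+\beta+1)_k}{k!\,(\alpha+1)_k}\Big(\frac{1-x}{2}\Big)^k$$ (this formula is used also when the second parameter is $\le -1$). *)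

(* Defs.v *)
From HB Require Import structures.
From mathcomp Require Import all_boot all_order all_algebra.
Set Implicit Arguments. Unset Strict Implicit. Unset Printing Implicit Defensive.
Import Order.TTheory GRing.Theory Num.Theory.
Local Open Scope ring_scope.

Definition poch (R : nzRingType) (a : R) (m : nat) : R :=
  \prod_(i < m) (a + i%:R).

(* Jacobi polynomial P_n^{(al,be)}(x) via the hypergeometric formula *)
Definition jacobiP (C : fieldType) (n : nat) (al be : C) : {poly C} :=
  (poch (al + 1) n / (n`!)%:R) *:
  \sum_(k < n.+1)
     ((poch (- n%:R) k * poch (n%:R + al + be + 1) k)
        / ((k`!)%:R * poch (al + 1) k))
     *: ((1 - 'X) * (2%:R)^-1%:P) ^+ k.

Definition Phi1 (C : fieldType) (n : nat) (al be : C) : {poly C} :=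
  \poly_(k < n.+1) ((jacobiP n al (be - 1))^`(k)).[1].

(* Main.v *)
Require Import Defs.
From HB Require Import structures.
From mathcomp Require Import all_boot all_order all_algebra.
From mathcomp Require Import ring.
Import Order.TTheory GRing.Theory Num.Theory.
Local Open Scope ring_scope.

(* Put s = (1-x)/2, a = al+1, N = n-1+a+be, P = 2F1(-n,N;a;s), z = mu/2 and
   F = sum_k (-z)^k P^(k), so that F + z F' = P and F(0) is Phi_n(1;mu) up to a
   nonzero constant.  Suppose F(0) = 0 and Re z >= 0.  Write M for integration
   against s^(a-1) (1-s)^(c-1), a functional on polynomials, and take the real
   part of M[(1-s) (F + z F') conj F'] = M[(1-s) P conj F'].  As F(0) = 0,
   integrating (|F|^2)' by parts shows that the left-hand side is positive.

   If be > 1, take c = be - 1: the right-hand side is 0 by orthogonality.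

   If be <= 1, take c = be + 1: P is orthogonal only to degree <= n-2, and from
   F' = P' - z P'' + z^2 F''' the right-hand side is X - conj(z) Y, where
   X = M[(1-s) P P'] and Y = M[(1-s) P P''] = -(n-1) M[P P'].  Eliminating P
   through its differential equation turns M[V P P'] into a weighted integral of
   -P'^2, which gives X < 0 and Y > 0. *)

(** * Rising factorials *)

Lemma poch0 (R : nzRingType) (a : R) : poch a 0 = 1.
Proof. by rewrite /poch big_ord0. Qed.

Lemma pochSr (R : nzRingType) (a : R) k : poch a k.+1 = poch a k * (a + k%:R).
Proof. by rewrite /poch big_ord_recr. Qed.

Lemma pochS (R : nzRingType) (a : R) k : poch a k.+1 = a * poch (a + 1) k.
Proof.
rewrite /poch big_ord_recl /= addr0; congr (_ * _).
by apply: eq_bigr => i _; rewrite /bump add1n -addrA nat1r.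
Qed.

Lemma poch_gt0 (C : numDomainType) (a : C) k : 0 < a -> 0 < poch a k.
Proof. by move=> a0; rewrite prodr_gt0 // => i _; rewrite ltr_wpDr. Qed.

Lemma pochN_eq0 (R : nzRingType) n k : (n < k)%N -> poch (- n%:R : R) k = 0.
Proof.
elim: k => // k IH; rewrite ltnS leq_eqVlt pochSr => /orP[/eqP->|/IH->].
  by rewrite addNr mulr0.
by rewrite mul0r.
Qed.

(** * The beta functional and its basic identities *)

(* The linear functional with the moments of the weight s^(a-1) (1-s)^(c-1)
   on [0,1], normalised to total mass 1. *)
Definition betaL {C : fieldType} (a c : C) (h : {poly C}) : C :=
  \sum_(i < size h) h`_i * (poch a i / poch (a + c) i).

Lemma betaL_wide {C : fieldType} (a c : C) (h : {poly C}) m : (size h <= m)%N ->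
  betaL a c h = \sum_(i < m) h`_i * (poch a i / poch (a + c) i).
Proof.
move=> hm; rewrite /betaL (big_ord_widen m (fun i => h`_i * (poch a i / poch (a + c) i))) //.
rewrite big_mkcond /=; apply: eq_bigr => i _; case: ltnP => // hi.
by rewrite nth_default // mul0r.
Qed.

Lemma betaL_is_linear {C : fieldType} (a c : C) : linear_for *%R (betaL a c).
Proof.
move=> k p q; pose m := maxn (size (k *: p + q)) (maxn (size p) (size q)).
rewrite !(@betaL_wide _ _ _ _ m) ?leq_max ?leqnn ?orbT //.
rewrite mulr_sumr -big_split /=; apply: eq_bigr => i _.
by rewrite coefD coefZ mulrDl mulrA.
Qed.

HB.instance Definition _ {C : fieldType} (a c : C) :=
  GRing.isLinear.Build C {poly C} C *%R (betaL a c) (betaL_is_linear a c).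

Lemma betaLZ {C : fieldType} (a c k : C) h : betaL a c (k%:P * h) = k * betaL a c h.
Proof. by rewrite mul_polyC linearZ. Qed.

Lemma betaLD {C : fieldType} (a c : C) p q :
  betaL a c (p + q) = betaL a c p + betaL a c q.
Proof. exact: linearD. Qed.

Lemma betaLB {C : fieldType} (a c : C) p q :
  betaL a c (p - q) = betaL a c p - betaL a c q.
Proof. exact: linearB. Qed.

Lemma betaLN {C : fieldType} (a c : C) p : betaL a c (- p) = - betaL a c p.
Proof. exact: linearN. Qed.

Lemma betaL_Xn {C : fieldType} (a c : C) k :
  betaL a c 'X^k = poch a k / poch (a + c) k.
Proof.
rewrite /betaL size_polyXn big_ord_recr /= coefXn eqxx mul1r big1 ?add0r // => i _.
by rewrite coefXn ltn_eqF // mul0r.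
Qed.

(** Reduces the identities for [betaL] below to monomials, where they become relations between
    moments. *)
Lemma linear_Xn_eq0 {C : fieldType} (T : {poly C} -> C) : linear_for *%R T ->
  (forall k, T 'X^k = 0) -> forall h, T h = 0.
Proof.
move=> Tlin T0 h.
pose TT : {linear {poly C} -> C | *%R} :=
  HB.pack T (GRing.isLinear.Build C {poly C} C *%R T Tlin).
change (TT h = 0); rewrite -[h]coefK poly_def linear_sum big1 // => i _.
by rewrite linearZ -[TT _]/(T _) T0; apply: mulr0.
Qed.

(* 2F1(-n, N; a; s) *)
Definition gauss {C : fieldType} n (N a : C) : {poly C} :=
  \poly_(k < n.+1) (poch (- n%:R) k * poch N k / (k`!%:R * poch a k)).

Section BetaFunctional.
Context {C : numClosedFieldType}.
Implicit Types (a c : C) (h f : {poly C}).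

(** Conjugates the coefficients, so that [f * cj f] takes the value |f(s)|^2 at real s. *)
Local Notation cj := (map_poly (Num.Def.conjC : {rmorphism C -> C})).

(** The integrand is the derivative of s^a (1-s)^c h, which vanishes at 0 and 1 as a, c > 0. On s^k
    this is the recursion between consecutive moments. *)
Lemma betaL_ibp a c h : 0 < a -> 0 < c ->
  betaL a c ('X * (1 - 'X) * h^`() + (a%:P - (a + c)%:P * 'X) * h) = 0.
Proof.
move=> a0 c0.
pose T h := betaL a c ('X * (1 - 'X) * h^`() + (a%:P - (a + c)%:P * 'X) * h).
have Tlin : linear_for *%R T.
  move=> k p q; rewrite /T -betaLZ -linearD /= derivD derivZ -!mul_polyC; congr betaL; ring.
apply: (@linear_Xn_eq0 _ T) => // k; rewrite /= /T derivXn.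
have -> : 'X * (1 - 'X) * ('X^(k.-1) *+ k) + (a%:P - (a + c)%:P * 'X) * 'X^k
  = (a + k%:R)%:P * 'X^k - (a + c + k%:R)%:P * 'X^(k.+1) :> {poly C}.
  case: k => [|k] /=; first by rewrite expr0; ring.
  rewrite !exprS; ring.
rewrite linearB /= !betaLZ !betaL_Xn !pochSr.
have h1 : poch (a + c) k != 0 by rewrite gt_eqF // poch_gt0 // addr_gt0.
have h2 : a + c + k%:R != 0 by rewrite gt_eqF // ltr_wpDr // addr_gt0.
by field; rewrite h1 h2.
Qed.

(** The factor s is absorbed into the weight; a/(a+c) is the ratio of the total masses, as both
    functionals are normalised. *)
Lemma betaL_mulX a c h : 0 < a -> 0 < c ->
  betaL a c ('X * h) = a / (a + c) * betaL (a + 1) c h.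
Proof.
move=> a0 c0; apply/eqP; rewrite -subr_eq0; apply/eqP.
pose T h := betaL a c ('X * h) - a / (a + c) * betaL (a + 1) c h.
have Tlin : linear_for *%R T.
  by move=> k p q; rewrite /T mulrDr -scalerAr !linearD !linearZ /=; ring.
apply: (@linear_Xn_eq0 _ T) => // k; rewrite /= /T -exprS !betaL_Xn !pochS.
have ac : 0 < a + c by rewrite addr_gt0.
have -> : a + 1 + c = a + c + 1 by ring.
have h1 : poch (a + c + 1) k != 0 by rewrite gt_eqF // poch_gt0 // addr_gt0.
by field; rewrite h1 gt_eqF.
Qed.

Lemma betaL_mulXC a c h : 0 < a -> 0 < c ->
  betaL a c ((1 - 'X) * h) = c / (a + c) * betaL a (c + 1) h.
Proof.
move=> a0 c0; apply/eqP; rewrite -subr_eq0; apply/eqP.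
pose T h := betaL a c ((1 - 'X) * h) - c / (a + c) * betaL a (c + 1) h.
have Tlin : linear_for *%R T.
  by move=> k p q; rewrite /T mulrDr -scalerAr !linearD !linearZ /=; ring.
apply: (@linear_Xn_eq0 _ T) => // k.
rewrite /= /T mulrBl mul1r -exprS linearB /= !betaL_Xn !addrA.
have ac : 0 < a + c by rewrite addr_gt0.
have h1 : poch (a + c) k != 0 by rewrite gt_eqF // poch_gt0.
have h2 : poch (a + c + 1) k = poch (a + c) k * (a + c + k%:R) / (a + c).
  by rewrite -pochSr pochS mulrAC mulfV ?mul1r // gt_eqF.
have h3 : a + c + k%:R != 0 by rewrite gt_eqF // ltr_wpDr.
rewrite h2 !pochSr; field; by rewrite h1 h3 gt_eqF.
Qed.


Lemma cjK f : cj (cj f) = f.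
Proof. by apply/polyP => i; rewrite !coef_map /= conjCK. Qed.

Lemma conjC_gt0 a : 0 < a -> a^* = a.
Proof. by move=> a0; rewrite conj_Creal ?gtr0_real. Qed.

Lemma poch_conj a k : a^* = a -> (poch a k)^* = poch a k.
Proof.
by move=> ha; rewrite rmorph_prod /=; apply: eq_bigr => i _; rewrite rmorphD /= ha rmorph_nat.
Qed.

Lemma betaL_cj a c f : 0 < a -> 0 < c -> betaL a c (cj f) = (betaL a c f)^*.
Proof.
move=> /conjC_gt0 ha /conjC_gt0 hc; rewrite /betaL size_map_poly rmorph_sum /=.
apply: eq_bigr => i _; rewrite coef_map /= rmorphM fmorph_div /= !poch_conj //.
by rewrite rmorphD /= ha hc.
Qed.

(** * Eigenpolynomials and orthogonality *)

(** The operator L q = s(1-s) q'' + (a - (a+c)s) q' is symmetric for the weight: J L q - q L J is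
    what integration by parts yields for J q' - J' q. *)
Lemma ode_selfadj a c lam (J q : {poly C}) : 0 < a -> 0 < c ->
  'X * (1 - 'X) * J^`()^`() + (a%:P - (a + c)%:P * 'X) * J^`() = - (lam%:P * J) ->
  betaL a c (J * ('X * (1 - 'X) * q^`()^`() + (a%:P - (a + c)%:P * 'X) * q^`()))
  = - (lam * betaL a c (J * q)).
Proof.
move=> a0 c0 ode; rewrite -betaLZ -linearN.
have -> : - (lam%:P * (J * q)) = - (lam%:P * J) * q by rewrite mulrA mulNr.
rewrite -ode; apply/eqP.
rewrite -subr_eq0 -linearB /=; apply/eqP.
have h1 := betaL_ibp a c (J * q^`()) a0 c0.
have h2 := betaL_ibp a c (J^`() * q) a0 c0.
have := subrr (0 : C); rewrite -{1}h1 -{1}h2 -linearB /= => <-.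
rewrite !derivM; congr betaL; ring.
Qed.

(** L maps s^j to a combination of s^j and s^(j-1), with diagonal entry -j(j-1+a+c). For j < d this
    differs from -lam, so symmetry kills the moments of J one after another. *)
Lemma ode_orth a c lam (J : {poly C}) d : 0 < a -> 0 < c ->
  'X * (1 - 'X) * J^`()^`() + (a%:P - (a + c)%:P * 'X) * J^`() = - (lam%:P * J) ->
  lam = d%:R * (d%:R - 1 + a + c) ->
  forall q : {poly C}, (size q <= d)%N -> betaL a c (J * q) = 0.
Proof.
move=> a0 c0 ode hlam q hq.
have ac : 0 < a + c by rewrite addr_gt0.
have mono k : (k < d)%N -> betaL a c (J * 'X^k) = 0.
  elim: k => [|k IH] kd; have sa := fun q => ode_selfadj a c lam J q a0 c0 ode.
    have /eqP := sa 1; rewrite expr0 derivC deriv0 !mulr0 addr0 mulr0 linear0.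
    rewrite eq_sym oppr_eq0 mulf_eq0 => /orP[|/eqP//].
    rewrite hlam mulf_eq0 pnatr_eq0 gtn_eqF //= gt_eqF // -addrA ltr_wpDl //.
    by rewrite subr_ge0 ler1n.
  have /eqP := sa 'X^(k.+1).
  have -> : J * ('X * (1 - 'X) * ('X^(k.+1))^`()^`()
              + (a%:P - (a + c)%:P * 'X) * ('X^(k.+1))^`())
    = (k.+1%:R * (k%:R + a))%:P * (J * 'X^k)
      - (k.+1%:R * (k%:R + a + c))%:P * (J * 'X^(k.+1)).
    rewrite !derivXn /= derivMn derivXn; case: k {IH kd} => [|k] /=; rewrite ?exprS; ring.
  rewrite [betaL _ _ (_ - _)]linearB /= !betaLZ IH 1?ltnW // mulr0 sub0r eqr_opp
    -subr_eq0 -mulrBl.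
  rewrite mulf_eq0 => /orP[|/eqP//].
  (* The difference of two eigenvalues factors, and neither factor vanishes for k+1 < d. *)
  have -> : k.+1%:R * (k%:R + a + c) - lam = - ((d - k.+1)%:R * ((d + k)%N%:R + a + c)).
    by rewrite hlam natrB ?(ltnW kd) // natrD -natr1; ring.
  rewrite oppr_eq0 mulf_eq0 pnatr_eq0 subn_eq0 leqNgt kd /=.
  by rewrite gt_eqF // -addrA ltr_wpDl.
rewrite -[q]coefK poly_def mulr_sumr linear_sum /= big1 // => i _.
by rewrite -scalerAr linearZ /= mono ?mulr0 // (leq_trans (ltn_ord i)).
Qed.

(** * Gauss polynomials: coefficients, differential equation, degree *)

Lemma coef_gauss n N a k :
  (gauss n N a)`_k = poch (- n%:R) k * poch N k / (k`!%:R * poch a k).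
Proof.
by rewrite coef_poly ltnS; case: leqP => // nk; rewrite pochN_eq0 // !mul0r.
Qed.

Lemma gauss_rec n N a k : 0 < a ->
  (k%:R + 1) * (a + k%:R) * (gauss n N a)`_k.+1 =
  (k%:R - n%:R) * (N + k%:R) * (gauss n N a)`_k.
Proof.
move=> a0; rewrite !coef_gauss !pochSr factS natrM -natr1.
have pk : poch a k != 0 by rewrite gt_eqF // poch_gt0.
have fk : k`!%:R != 0 :> C by rewrite pnatr_eq0 -lt0n fact_gt0.
have ak : a + k%:R != 0 by rewrite gt_eqF // ltr_wpDr.
have nk : k%:R + 1 != 0 :> C by rewrite natr1 pnatr_eq0.
by field; rewrite nk fk ak pk.
Qed.

(** The hypergeometric equation, read off from the coefficient recursion. It is the eigenvalue
    equation for the weight (a, c) when a + c = N + 1 - n. *)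
Lemma gauss_ode n N a : 0 < a ->
  'X * (1 - 'X) * (gauss n N a)^`()^`()
    + (a%:P - (N + 1 - n%:R)%:P * 'X) * (gauss n N a)^`()
  = - ((n%:R * N)%:P * gauss n N a).
Proof.
move=> a0; set P := gauss n N a.
have -> : 'X * (1 - 'X) * P^`()^`() + (a%:P - (N + 1 - n%:R)%:P * 'X) * P^`()
  = 'X * P^`()^`() - 'X * ('X * P^`()^`()) + a%:P * P^`()
    - (N + 1 - n%:R)%:P * ('X * P^`()) by ring.
apply/polyP => k; have := @gauss_rec n N a k a0.
rewrite coefB coefD coefB coefN !coefCM !coefXM !coef_deriv -/P => h.
apply/eqP; rewrite -subr_eq0.
rewrite -[X in _ == X](subrr ((k%:R - n%:R) * (N + k%:R) * P`_k)) -{1}h; apply/eqP.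
by case: k {h} => [|[|k]] /=; ring.
Qed.

Lemma cj_gauss n N a : a^* = a -> N^* = N -> cj (gauss n N a) = gauss n N a.
Proof.
move=> ha hN; apply/polyP => k; rewrite coef_map /= !coef_gauss.
rewrite fmorph_div /= !rmorphM /= !poch_conj ?rmorph_nat //.
by rewrite rmorphN rmorph_nat.
Qed.

Lemma gauss_lead_neq0 n N a : 0 < a -> 0 < N -> (gauss n N a)`_n != 0.
Proof.
move=> a0 N0; rewrite coef_gauss mulf_neq0 ?invr_neq0 ?mulf_neq0 //.
- apply/prodf_neq0 => i _; rewrite addrC subr_eq0 eqr_nat.
  by rewrite neq_ltn ltn_ord.
- by rewrite gt_eqF // poch_gt0.
- by rewrite pnatr_eq0 -lt0n fact_gt0.
- by rewrite gt_eqF // poch_gt0.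
Qed.

Lemma size_gauss n N a : 0 < a -> 0 < N -> size (gauss n N a) = n.+1.
Proof.
move=> a0 N0; apply/eqP; rewrite eqn_leq size_poly /=.
by rewrite ltnNge; apply: contra (gauss_lead_neq0 n N a a0 N0) => /leq_sizeP ->.
Qed.

(** * Positivity of the functional on squares *)

Lemma deriv_neq0 (f : {poly C}) : (1 < size f)%N -> f^`() != 0.
Proof.
move=> sf; have hf : f`_(size f).-1 != 0.
  by rewrite -lead_coefE lead_coef_eq0 -size_poly_gt0 ltnW.
apply: contra hf => /eqP h; move: (coef_deriv f (size f).-2).
rewrite h coef0 => /eqP; rewrite eq_sym mulrn_eq0 /=.
by case: (size f) sf => [|[]].
Qed.

Lemma size_deriv_le (f : {poly C}) n : (size f <= n.+1)%N -> (size f^`() <= n)%N.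
Proof.
have [->|f0 hf] := eqVneq f 0; first by rewrite deriv0 size_poly0.
by rewrite -ltnS (leq_trans (lt_size_deriv f0)).
Qed.

(* Induction on the degree: splitting off the eigenpolynomial J of the top degree
   leaves an orthogonal remainder, and integrating by parts turns the norm of J
   into that of J', of lower degree, for the parameters a+1 and c+1. *)
Lemma betaL_sqr_gt0 a c f : 0 < a -> 0 < c -> f != 0 -> 0 < betaL a c (f * cj f).
Proof.
have [d] := ubnP (size f).-1; elim: d a c f => // d IH a c f hd a0 c0 f0.
have ac : 0 < a + c by rewrite addr_gt0.
case: (posnP (size f).-1) => [sf|sf].
  have [k fk] : exists k, f = k%:P.
    by exists f`_0; apply: size1_polyC; case: (size f) sf => [|[]].
  have k0 : k != 0 by move: f0; rewrite fk polyC_eq0.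
  rewrite fk map_polyC /= betaLZ -[k^*%:P]mulr1 betaLZ -(expr0 'X) betaL_Xn !poch0.
  by rewrite divr1 mulr1 mul_conjC_gt0.
set D := (size f).-1 in hd sf.
have sfD : size f = D.+1 by rewrite prednK // size_poly_gt0.
(* This N makes [gauss D N a] the degree D orthogonal polynomial of the weight (a, c). *)
pose N := D%:R - 1 + a + c.
have N0 : 0 < N by rewrite /N -addrA ltr_wpDl // subr_ge0 ler1n.
pose J := gauss D N a.
have JD := gauss_lead_neq0 D N a a0 N0; rewrite -/J in JD.
have sJ : size J = D.+1 by apply: size_gauss.
have J0 : J != 0 by rewrite -size_poly_gt0 sJ.
have ode : 'X * (1 - 'X) * J^`()^`() + (a%:P - (a + c)%:P * 'X) * J^`()
    = - ((D%:R * N)%:P * J).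
  by rewrite -gauss_ode // /N; congr (_ + (_ - _%:P * _) * _); ring.
have cJ : cj J = J.
  by apply: cj_gauss; rewrite conjC_gt0.
have orth (q : {poly C}) : (size q <= D)%N -> betaL a c (J * q) = 0.
  by apply: (ode_orth a c _ J D a0 c0 ode); rewrite /N.
have JJ : 0 < betaL a c (J * J).
  (* Integration by parts applied to J J': the eigenvalue times the norm of J is the integral of
     s(1-s) J'^2. *)
  have h : D%:R * N * betaL a c (J * J) = betaL a c ('X * ((1 - 'X) * (J^`() * cj J^`()))).
    have := betaL_ibp a c (J * J^`()) a0 c0.
    rewrite derivM.
    have -> : 'X * (1 - 'X) * (J^`() * J^`() + J * J^`()^`())
         + (a%:P - (a + c)%:P * 'X) * (J * J^`())
       = 'X * ((1 - 'X) * (J^`() * J^`()))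
         + ('X * (1 - 'X) * J^`()^`() + (a%:P - (a + c)%:P * 'X) * J^`()) * J by ring.
    rewrite ode -deriv_map cJ mulNr -(mulrA _ J) [betaL _ _ (_ - _)]linearB /= betaLZ => /eqP.
    by rewrite subr_eq0 => /eqP.
  have DN : 0 < D%:R * N by rewrite mulr_gt0 ?ltr0n.
  rewrite -(pmulr_rgt0 _ DN) h.
  rewrite betaL_mulX // betaL_mulXC ?addr_gt0 //.
  apply: mulr_gt0; first by rewrite divr_gt0.
  apply: mulr_gt0; first by rewrite divr_gt0 ?addr_gt0.
  have J'0 : J^`() != 0 by rewrite deriv_neq0 // sJ.
  apply: IH; rewrite ?addr_gt0 //.
  have := lt_size_deriv J0; rewrite sJ ltnS => sJ'.
  by rewrite -ltnS prednK ?size_poly_gt0 // (leq_ltn_trans sJ').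
(* The leading terms cancel in r, so r is orthogonal to J and the norm of f splits by Pythagoras. *)
pose k := f`_D / J`_D; pose r : {poly C} := f - k%:P * J.
have sr : (size r <= D)%N.
  apply/leq_sizeP => i; rewrite leq_eqVlt => /orP[/eqP <-|hi].
    by rewrite coefB coefCM divfK // subrr.
  by rewrite coefB coefCM !nth_default ?mulr0 ?subrr // ?sfD ?sJ.
have fE : f = k%:P * J + r by rewrite /r addrC subrK.
clearbody r k.
have -> : betaL a c (f * cj f) = k * k^* * betaL a c (J * J) + betaL a c (r * cj r).
  have -> : f * cj f = (k * k^*)%:P * (J * J) + r * cj r
      + k%:P * (J * cj r) + k^*%:P * (J * r).
    have -> : cj f = k^*%:P * J + cj r by rewrite fE rmorphD rmorphM /= cJ map_polyC.
    rewrite {1}fE; move: (cj r) (k^*) => r' k'; ring.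
  by rewrite !betaLD !betaLZ (orth r) ?(orth (cj r)) ?size_map_poly // !mulr0 !addr0.
have r_gt0 : r != 0 -> 0 < betaL a c (r * cj r).
  move=> r0; apply: IH => //; rewrite -ltnS prednK ?size_poly_gt0 //.
  exact: leq_ltn_trans sr _.
have [k0|k0] := eqVneq k 0.
  by rewrite k0 mul0r mul0r add0r r_gt0 //; move: f0; rewrite fE k0 mul0r add0r.
apply: ltr_pwDl; first by rewrite mulr_gt0 ?mul_conjC_gt0.
have [->|/r_gt0/ltW//] := eqVneq r 0; by rewrite mul0r linear0.
Qed.

Lemma betaL_weighted_gt0 a c u v f : 0 < a -> 0 < c -> f != 0 ->
  0 < betaL a c ('X^u * ((1 - 'X) ^+ v * (f * cj f))).
Proof.
elim: u v a c => [|u IHu] v a c a0 c0 f0; last first.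
  rewrite exprS -mulrA betaL_mulX //.
  by apply: mulr_gt0; [rewrite divr_gt0 ?addr_gt0 | rewrite IHu ?addr_gt0].
rewrite expr0 mul1r; elim: v c c0 => [|v IHv] c c0.
  by rewrite expr0 mul1r betaL_sqr_gt0.
rewrite exprS -mulrA betaL_mulXC //.
by apply: mulr_gt0; [rewrite divr_gt0 ?addr_gt0 | rewrite IHv ?addr_gt0].
Qed.

(** * Gauss polynomials against the weight with c raised by one *)

Lemma size_1subX : size (1 - 'X : {poly C}) = 2.
Proof. by rewrite -opprB size_polyN -(polyC1 C) size_XsubC. Qed.

Lemma gauss_deriv_ode n N a : 0 < a ->
  let R := (gauss n N a)^`() in
  'X * (1 - 'X) * R^`()^`() + ((a + 1)%:P - (a + 1 + (N - a + 2 - n%:R))%:P * 'X) * R^`()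
  = - (((n%:R - 1) * (N + 1))%:P * R).
Proof.
move=> a0 R; have := congr1 deriv (gauss_ode n N a a0); rewrite -/R.
rewrite !(derivE, derivM) -/R => /eqP; rewrite -subr_eq0 => /eqP h.
by apply/eqP; rewrite -subr_eq0 -h; apply/eqP; ring.
Qed.

(** The natural weight of P has second parameter c - 1, which may be non-positive. Hence the detour
    through P', an eigenpolynomial for (a+1, c): the equation of P and integration by parts turn n N
    M[P q] into M[s P' ((1-s) q)']. *)
Lemma gauss_orth n N a c : 0 < a -> 0 < c -> 0 < N -> (0 < n)%N -> a + c = N + 2 - n%:R ->
  forall q : {poly C}, (size q <= n.-1)%N -> betaL a c (gauss n N a * q) = 0.
Proof.
move=> a0 c0 N0 n0 hac q hq; set P := gauss n N a; pose R := P^`().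
have cE : c = N - a + 2 - n%:R by rewrite -[c](addKr a) hac; ring.
have Pode := gauss_ode n N a a0; rewrite -/P -/R in Pode.
have nN : n%:R * N != 0 :> C by rewrite mulf_neq0 ?pnatr_eq0 -?lt0n // gt_eqF.
have Rode := gauss_deriv_ode n N a a0; rewrite /= -/P -/R -cE in Rode.
apply: (mulfI nN); rewrite mulr0 -betaLZ mulrA.
rewrite -[_%:P * P]opprK -Pode.
have := betaL_ibp a c (R * q) a0 c0; rewrite derivM => ibp.
rewrite -[LHS]addr0 -{1}ibp -betaLD.
set U := (X in betaL _ _ X).
have -> : U = 'X * (R * ((1 - 'X) * q)^`()).
  by rewrite /U hac derivM derivB derivC derivX; ring.
rewrite betaL_mulX //. apply/eqP; rewrite mulf_eq0; apply/orP; right; apply/eqP.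
have a10 : 0 < a + 1 by rewrite addr_gt0.
apply: (ode_orth _ _ _ _ n.-1 a10 c0 Rode).
  have -> : n.-1%:R = n%:R - 1 :> C by rewrite -subn1 natrB.
  by rewrite cE; ring.
apply: size_deriv_le; rewrite (leq_trans (size_polyMleq _ _)) //.
by rewrite size_1subX add2n /= -(prednK n0).
Qed.

(** Integration by parts applied to V P'^2; the equation of P trades the P' P'' term for P P' and
    P'^2. *)
Lemma gauss_energy n N a c (V : {poly C}) : 0 < a -> 0 < c -> a + c = N + 2 - n%:R ->
  let P := gauss n N a in let R := P^`() in
  2%:R * (n%:R * N) * betaL a c (V * (P * R)) =
  - betaL a c (R * R * ((a%:P + (2%:R%:P - (a + c)%:P) * 'X) * V - 'X * (1 - 'X) * V^`())).
Proof.
move=> a0 c0 hac P R; have Pode := gauss_ode n N a a0; rewrite -/P -/R in Pode.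
have := betaL_ibp a c (V * (R * R)) a0 c0; rewrite !derivM => ibp.
rewrite -[LHS]addr0 -{}ibp -betaLN -betaLZ -betaLD; congr betaL.
have -> : (2%:R * (n%:R * N))%:P * (V * (P * R))
  = - (2%:R%:P * V * R * - ((n%:R * N)%:P * P)) by ring.
by rewrite -Pode hac; ring.
Qed.

(** * The sign argument *)

(** Moves the derivative from |F|^2 to s^(a-1) (1-s)^c. The divisor s of F removes the boundary term
    at 0 and turns s^(a-2) |F|^2 into s^a |F1|^2. Both coefficients are positive once a < 1. *)
Lemma betaL_norm_deriv a c (F1 : {poly C}) : 0 < a -> 0 < c ->
  let F := 'X * F1 in
  betaL a c ((1 - 'X) * (F * cj F^`() + cj F * F^`())) =
  (1 - a) * betaL a c ('X * ((1 - 'X) * (F1 * cj F1))) +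
  c * betaL a c ('X * ('X * (F1 * cj F1))).
Proof.
move=> a0 c0 F.
have := betaL_ibp a c ('X * (F1 * cj F1)) a0 c0; rewrite !derivM derivX => ibp.
rewrite -[RHS]addr0 -{}ibp -!betaLZ -!betaLD; congr betaL.
rewrite /F !(rmorphD, rmorphM, rmorph1) /= map_polyX deriv_map.
ring.
Qed.

Lemma Re_lt0_of_F0_eq0 n a b z (F : {poly C}) :
  0 < a -> a < 1 -> -1 < b -> (2 <= n)%N ->
  (size F <= n.+1)%N -> F.[0] = 0 ->
  F + z%:P * F^`() = gauss n (n%:R - 1 + a + b) a -> 'Re z < 0.
Proof.
move=> a0 a1 b1 n2 sF F0 FE; set N := _ - _ + _ + _ in FE.
have b1' : 0 < b + 1 by move: b1; rewrite -subr_gt0 opprK.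
have n0 : (0 < n)%N by apply: ltnW.
have N0 : 0 < N.
  have -> : N = (n - 2)%N%:R + (a + (b + 1)) by rewrite natrB //; rewrite /N; ring.
  by rewrite ltr_wpDl // addr_gt0.
set P := gauss n N a in FE; set g := F^`() in FE; pose R := P^`().
have cP : cj P = P.
  apply: cj_gauss; first exact: conjC_gt0.
  exact: conjC_gt0.
have sP : size P = n.+1 by apply: size_gauss.
have R0 : R != 0 by rewrite deriv_neq0 // sP ltnS.
rewrite real_ltNge ?Creal_Re //; apply/negP => Rez.
have z0 : 0 <= z + z^*.
  have -> : z + z^* = 2%:R * 'Re z by rewrite ReE mulrC divfK // pnatr_eq0.
  by rewrite mulr_ge0.
have [F1 FF] : exists F1, F = 'X * F1.
  have /factor_theorem[F1 FE1] : root F 0 by apply/rootP.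
  by exists F1; rewrite FE1 subr0 mulrC.
have Fn0 : F != 0.
  apply/eqP => F00; move: sP; rewrite -FE /g F00 deriv0 mulr0 addr0.
  by rewrite size_poly0.
have F10 : F1 != 0 by apply: contraNneq Fn0 => F10; rewrite FF F10 mulr0.
have sg : (size g <= n)%N by apply: size_deriv_le.
have norm_deriv c' : 0 < c' -> betaL a c' ((1 - 'X) * (F * cj g + cj F * g)) =
    (1 - a) * betaL a c' ('X * ((1 - 'X) * (F1 * cj F1)))
    + c' * betaL a c' ('X * ('X * (F1 * cj F1))).
  by move=> c'0; rewrite /g FF; apply: betaL_norm_deriv.
(* Twice the real part of P = F + z F' multiplied by (1-s) conj F' and integrated. *)
have Re2 a' c' : 0 < a' -> 0 < c' -> betaL a' c' ((1 - 'X) * (F * cj g + cj F * g))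
   + (z + z^*) * betaL a' c' ((1 - 'X) * (g * cj g))
   = betaL a' c' ((1 - 'X) * (P * cj g)) + (betaL a' c' ((1 - 'X) * (P * cj g)))^*.
  move=> a'0 c'0; rewrite -betaL_cj // -betaLZ -!betaLD; congr betaL.
  have -> : cj ((1 - 'X) * (P * cj g)) = (1 - 'X) * (cj P * g).
    by rewrite rmorphM rmorphB rmorph1 rmorphM /= map_polyX cjK.
  have -> : cj P = cj F + z^*%:P * cj g by rewrite -FE rmorphD rmorphM /= map_polyC.
  rewrite -FE rmorphD /=; ring.
have nonneg u v : 0 < v -> 0 <= betaL a v ('X^u * ((1 - 'X) * (g * cj g))).
  move=> v0; have [->|g0] := eqVneq g 0; first by rewrite mul0r !mulr0 linear0.
  by rewrite -{1}[1 - 'X]expr1 ltW // betaL_weighted_gt0.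
have br : b \is Num.real.
  by rewrite -[b](addrK 1) rpredB ?rpred1 // gtr0_real.
case: (real_leP br (@real1 _)) => hb; last first.
  have c0 : 0 < b - 1 by rewrite subr_gt0.
  have := Re2 a (b - 1) a0 c0.
  (* The factor 1-s raises the parameter to b, the natural weight of P, and F' has degree below
     n. *)
  have -> : betaL a (b - 1) ((1 - 'X) * (P * cj g)) = 0.
    rewrite betaL_mulXC // subrK.
    have b0 : 0 < b by apply: lt_trans hb.
    rewrite (@ode_orth a b (n%:R * N) P n) ?mulr0 ?size_map_poly //.
      rewrite -gauss_ode // /N; congr (_ + (_ - _%:P * _) * _); ring.
  rewrite norm_deriv // conjC0 addr0.
  apply/eqP; rewrite gt_eqF //.
  apply: ltr_pwDl; last first.
    by rewrite mulr_ge0 //; have := nonneg 0%N _ c0; rewrite expr0 mul1r.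
  apply: ltr_pwDl; last first.
    rewrite mulr_ge0 ?ltW // mulrA -expr2.
    by have := betaL_weighted_gt0 a (b - 1) 2 0 F1 a0 c0 F10; rewrite expr0 mul1r.
  rewrite mulr_gt0 ?subr_gt0 //.
  by have := betaL_weighted_gt0 a (b - 1) 1 1 F1 a0 c0 F10; rewrite !expr1.
have hac : a + (b + 1) = N + 2 - n%:R by rewrite /N; ring.
have orth := gauss_orth n N a (b + 1) a0 b1' N0 n0 hac.
have nN : 0 < 2%:R * (n%:R * N) by rewrite !mulr_gt0 ?ltr0n.
have cR : cj R = R by rewrite -deriv_map cP.
have wpos u v := betaL_weighted_gt0 a (b + 1) u v R a0 b1' R0.
pose X := betaL a (b + 1) ((1 - 'X) * (P * R)).
pose Y0 := betaL a (b + 1) (P * R).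
have X_lt0 : X < 0.
  rewrite -(pmulr_rlt0 _ nN) gauss_energy // -/P -/R oppr_lt0.
  set U := (U in betaL _ _ U).
  (* With V = 1-s the energy density is (1-s)(a(1-s) + (2-b)s) P'^2; with V = 1 below it is (a(1-s)
     + (1-b)s) P'^2, whence the use of b <= 1. *)
  have -> : U = a%:P * ('X^0 * ((1 - 'X) ^+ 2 * (R * cj R)))
              + (2%:R - b)%:P * ('X^1 * ((1 - 'X) ^+ 1 * (R * cj R))).
    by rewrite /U cR derivB derivC derivX; ring.
  have b2 : 0 < 2%:R - b by rewrite subr_gt0 (le_lt_trans hb) ?ltr1n.
  rewrite betaLD (betaLZ _ _ a) (betaLZ _ _ (2%:R - b)).
  by apply: addr_gt0; apply: mulr_gt0 => //; apply: wpos.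
have Y0_lt0 : Y0 < 0.
  rewrite /Y0 -[P * R]mul1r -(pmulr_rlt0 _ nN) gauss_energy // -/P -/R oppr_lt0.
  set U := (U in betaL _ _ U).
  have -> : U = a%:P * ('X^0 * ((1 - 'X) ^+ 1 * (R * cj R)))
              + (1 - b)%:P * ('X^1 * ((1 - 'X) ^+ 0 * (R * cj R))).
    by rewrite /U cR derivC; ring.
  rewrite betaLD (betaLZ _ _ a) (betaLZ _ _ (1 - b)); apply: ltr_pwDl.
    by apply: mulr_gt0 => //; apply: wpos.
  by rewrite mulr_ge0 ?subr_ge0 // ltW // wpos.
(* The terms of degree n-1 cancel in (1-s) P'' + (n-1) P', so P is orthogonal to it. *)
have YE : betaL a (b + 1) ((1 - 'X) * (P * R^`())) = - (n%:R - 1) * Y0.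
  apply/eqP; rewrite -subr_eq0 mulNr opprK -betaLZ -betaLD; apply/eqP.
  have -> : (1 - 'X) * (P * R^`()) + (n%:R - 1)%:P * (P * R)
    = P * ((1 - 'X) * R^`() + (n%:R - 1)%:P * R) by ring.
  apply: orth; apply/leq_sizeP => j hj.
  have Rn i : (n <= i)%N -> R`_i = 0.
    by move=> hi; rewrite nth_default // (leq_trans _ hi) // size_deriv_le ?sP.
  case: j hj => [|j] hj; first by move: n2 hj; case: (n) => [|[]].
  have jn : (n <= j.+2)%N by rewrite -(prednK n0) ltnS.
  rewrite mulrBl mul1r coefD coefB coefXM coefCM /= !(coef_deriv R) (Rn j.+2) // mul0rn sub0r.
  have [->|nj] := eqVneq n j.+2; first by rewrite -natr1 addrK mulr_natl addNr.
  by rewrite Rn ?mulr0 ?mul0rn ?oppr0 ?addr0 // -ltnS ltn_neqAle nj.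
(* Differentiating F + z F' = P gives F' = P' - z F''; this is substituted into itself once. *)
have gE : g = R - z%:P * R^`() + (z ^+ 2)%:P * g^`()^`().
  rewrite /R -FE !derivE -/g; ring.
(* (1-s) F''' has degree at most n-2, just within the reach of [orth]. *)
have tail : betaL a (b + 1) (P * ((1 - 'X) * cj g^`()^`())) = 0.
  apply: orth; rewrite (leq_trans (size_polyMleq _ _)) // size_1subX add2n /= size_map_poly.
  move: n2 sg; case: (n) => [|[|m]] //= _ sg.
  by rewrite ltnS; do 2!apply: size_deriv_le.
have cg : cj g = R - z^*%:P * R^`() + (z^* ^+ 2)%:P * cj g^`()^`().
  by rewrite {1}gE !rmorphD rmorphN !rmorphM /= !map_polyC /= cR -(deriv_map _ R) cR.
have := Re2 a (b + 1) a0 b1'.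
have -> : betaL a (b + 1) ((1 - 'X) * (P * cj g)) = X - z^* * (- (n%:R - 1) * Y0).
  rewrite -YE /X -betaLZ -betaLB -[RHS]addr0 -(mulr0 (z^* ^+ 2)) -{}tail -betaLZ -betaLD.
  by rewrite cg; congr betaL; ring.
have realL (f : {poly C}) : cj f = f -> (betaL a (b + 1) f)^* = betaL a (b + 1) f.
  by move=> hf; rewrite -betaL_cj // hf.
have cX : X^* = X.
  by apply: realL; rewrite rmorphM rmorphB rmorph1 rmorphM /= map_polyX cP cR.
have cY : Y0^* = Y0 by apply: realL; rewrite rmorphM /= cP cR.
rewrite norm_deriv //.
have -> : X - z^* * (- (n%:R - 1) * Y0) + (X - z^* * (- (n%:R - 1) * Y0))^*
   = 2%:R * X + (z + z^*) * ((n%:R - 1) * Y0).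
  rewrite !(rmorphB, rmorphM, rmorphN) /= cX cY conjCK rmorph1 rmorph_nat; ring.
move=> /eqP; apply/negP; rewrite gt_eqF //.
(* The right-hand side is negative through X, the left-hand side non-negative. *)
apply: (@lt_le_trans _ _ 0).
  apply: ltr_nwDl; first by rewrite pmulr_rlt0 ?ltr0n.
  rewrite mulr_ge0_le0 // mulr_ge0_le0 ?subr_ge0 ?ler1n // ltW //.
have w u v := betaL_weighted_gt0 a (b + 1) u v F1 a0 b1' F10.
apply: addr_ge0; last first.
  by rewrite mulr_ge0 //; have := nonneg 0%N _ b1'; rewrite expr0 mul1r.
apply: addr_ge0; rewrite mulr_ge0 ?subr_ge0 ?ltW //.
  by have := w 1%N 1%N; rewrite !expr1.
by have := w 2 0%N; rewrite expr0 mul1r expr2 -mulrA.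
Qed.

End BetaFunctional.

(** * Return to Jacobi polynomials *)

Lemma derivn_comp_affine (R : comNzRingType) (p l : {poly R}) (d : R) k :
  l^`() = d%:P -> (p \Po l)^`(k) = d ^+ k *: (p^`(k) \Po l).
Proof.
move=> hl; elim: k => [|k IH]; first by rewrite expr0 scale1r.
by rewrite derivnS IH derivZ deriv_comp hl -derivnS mulrC mul_polyC scalerA -exprSr.
Qed.

Lemma jacobiPE (C : fieldType) n (al be : C) :
  jacobiP n al be = (poch (al + 1) n / n`!%:R) *:
    (gauss n (n%:R + al + be + 1) (al + 1) \Po ((1 - 'X) * (2%:R)^-1%:P)).
Proof.
congr (_ *: _); rewrite /gauss poly_def linear_sum /=.
by apply: eq_bigr => k _; rewrite linearZ /= comp_Xn_poly.
Qed.

Theorem theorem4 (C : numClosedFieldType) (al be : C) (n : nat) :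
  -1 < al -> al < 0 -> -1 < be -> (4 <= n)%N ->
  forall mu : C, root (Phi1 n al be) mu -> 'Re mu < 0.
Proof.
move=> al1 al0 be1 n4 mu /rootP.
(* As d/dx = -(1/2) d/ds, the power mu^k becomes (-z)^k, and x = 1 becomes s = 0. *)
pose z := mu / 2%:R; pose P := gauss n (n%:R - 1 + (al + 1) + be) (al + 1).
pose F := \sum_(k < n.+1) (- z) ^+ k *: P^`(k).
have a0 : 0 < al + 1 by move: al1; rewrite -subr_gt0 opprK.
have sP : (size P <= n.+1)%N by apply: size_poly.
have sPk k : (size P^`(k) <= n.+1)%N.
  by elim: k => // k IH; rewrite derivnS size_deriv_le // (leq_trans IH).
have two0 : 2%:R != 0 :> C by rewrite pnatr_eq0.
have -> : (Phi1 n al be).[mu] = poch (al + 1) n / n`!%:R * F.[0].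
  rewrite /Phi1 horner_poly horner_sum mulr_sumr; apply: eq_bigr => k _.
  rewrite jacobiPE.
  have -> : n%:R + al + (be - 1) + 1 = n%:R - 1 + (al + 1) + be by ring.
  rewrite -/P derivnZ (@derivn_comp_affine _ _ _ (- 2%:R^-1)); last first.
    by rewrite !derivE; ring.
  rewrite !(hornerZ, horner_comp, hornerM, hornerD, hornerN, hornerX, hornerC) subrr mul0r.
  have -> : - z = - 2%:R^-1 * mu by rewrite /z; ring.
  by rewrite exprMn; ring.
move=> /eqP; rewrite mulf_eq0 => /orP[|/eqP F0].
  by rewrite mulf_eq0 invr_eq0 pnatr_eq0 -leqn0 leqNgt fact_gt0 orbF gt_eqF // poch_gt0.
(* The sum telescopes, and its last term contains the vanishing derivative of order n+1. *)
have FE : F + z%:P * F^`() = P.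
  have -> : F^`() = \sum_(k < n.+1) (- z) ^+ k *: P^`(k.+1).
    by rewrite /F linear_sum /=; apply: eq_bigr => k _; rewrite derivZ.
  have -> : z%:P * (\sum_(k < n.+1) (- z) ^+ k *: P^`(k.+1))
      = - \sum_(k < n.+1) (- z) ^+ k.+1 *: P^`(k.+1).
    rewrite mulr_sumr -sumrN; apply: eq_bigr => k _.
    by rewrite mul_polyC scalerA exprS mulNr scaleNr opprK.
  rewrite /F big_ord_recl big_ord_recr /= -derivnS (@derivn_poly0 _ P n.+1) //.
  rewrite scaler0 addr0 expr0 scale1r.
  by rewrite addrK.
have Rez : 'Re z < 0.
  apply: (@Re_lt0_of_F0_eq0 _ n (al + 1) be z F) => //.
  - by rewrite -subr_gt0 opprD addrCA subrr addr0 oppr_gt0.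
  - exact: leq_trans n4.
  - apply: (big_ind (fun p : {poly C} => size p <= n.+1)%N); first by rewrite size_poly0.
      by move=> p q hp hq; rewrite (leq_trans (size_polyD _ _)) // geq_max hp.
    by move=> k _; rewrite (leq_trans (size_scale_leq _ _)).
have -> : mu = z + z by rewrite /z; field.
by rewrite raddfD /= -oppr_gt0 opprD addr_gt0 ?oppr_gt0.
Qed.
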